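(* Let $\Sigma=(\mathcal{X},\mathcal{X}_0,g,M)$ be an interconnected monotone system consisting of $N$ scalar subsystems $\Sigma_i=(\mathcal{X}_i,\mathcal{X}_{0,i},\mathcal{W}_i,g_i)$, i.e. $n_i=m_i=1$ for all $i\in\{1,\ldots,N\}$, with unsafe set $\mathcal{X}_u=\prod_{i=1}^N\mathcal{X}_{u,i}$, $\mathcal{X}_{u,i}\subseteq\mathcal{X}_i$, and with state and input partitions having the covering properties described in the context. Fix $\lambda\ge0$ common to all subsystems. Suppose that the interconnection matrix $M\in\mathbb{R}^{N\times N}$ is symmetric, and that there exist interval-barrier functions $\mathcal{B}_i:\mathcal{X}_i\to\mathbb{R}$ for $\Sigma_i$, $i\in\{1,\ldots,N\}$, with associated scalars $\gamma_i,\eta_i\in\mathbb{R}$ and with the same symmetric matrix $X_i=X\in\mathbb{R}^{2\times2}$ for all $i$. Let $\mu_1,\ldots,\mu_N$ be the eigenvalues of $M$. If $$\begin{bmatrix} \mu_k \\ 1 \end{bmatrix}^\top X\begin{bmatrix} \mu_k \\ 1 \end{bmatrix}\le 0\ \text{ for every } k\in\{1,\ldots,N\},\qquad \sum_{i=1}^N\gamma_i\le0,\qquad \sum_{i=1}^N\eta_i>0,$$ then $\mathcal{B}(x)=\sum_{i=1}^N\mathcal{B}_i(x_i)$ is a barrier certificate for $\Sigma$ with respect to $\mathcal{X}_u$, and hence $\Sigma$ is safe with respect to $\mathcal{X}_u$.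
   Context: Notation: for vectors, $x\le y$ is coordinatewise; $[\underline{x},\overline{x}]=\{x:\underline{x}\le x\le\overline{x}\}$ (with $\underline{x}\le\overline{x}$). Interconnected system (scalar case): for $i\in\{1,\ldots,N\}$, $\Sigma_i=(\mathcal{X}_i,\mathcal{X}_{0,i},\mathcal{W}_i,g_i)$ has state set $\mathcal{X}_i\subseteq\mathbb{R}$, initial set $\mathcal{X}_{0,i}\subseteq\mathcal{X}_i$, internal input set $\mathcal{W}_i\subseteq\mathbb{R}$ and transition map $g_i:\mathcal{X}_i\times\mathcal{W}_i\to\mathcal{X}_i$, with $x_i^+=g_i(x_i,w_i)$. The subsystems are interconnected through $w=Mx$, where $x=(x_1,\ldots,x_N)^\top$, $w=(w_1,\ldots,w_N)^\top$, $M\in\mathbb{R}^{N\times N}$; it is required that $(Mx)_i\in\mathcal{W}_i$ for all $x\in\prod_i\mathcal{X}_i$ and all $i$. The interconnected system is $\Sigma=(\mathcal{X},\mathcal{X}_0,g,M)$ with $\mathcal{X}=\prod_i\mathcal{X}_i$, $\mathcal{X}_0=\prod_i\mathcal{X}_{0,i}$, and $g:\mathcal{X}\to\mathcal{X}$, $g(x)=(g_1(x_1,(Mx)_1),\ldots,g_N(x_N,(Mx)_N))^\top$. It is an interconnected monotone system if each $\Sigma_i$ is monotone: $x\le y$ and $w\le v$ imply $g_i(x,w)\le g_i(y,v)$. Partitions: for each $i$ there are finite families of intervals $\{[\underline{x}_i^j,\overline{x}_i^j]\}_{j\in\mathcal{P}_i}$ and $\{[\underline{w}_i^k,\overline{w}_i^k]\}_{k\in\mathcal{Q}_i}$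 with $\mathcal{X}_i=\bigcup_{j\in\mathcal{P}_i}[\underline{x}_i^j,\overline{x}_i^j]$ and $\mathcal{W}_i=\bigcup_{k\in\mathcal{Q}_i}[\underline{w}_i^k,\overline{w}_i^k]$, and index sets $\mathcal{I}_i,\mathcal{U}_i\subseteq\mathcal{P}_i$ with $\mathcal{X}_{0,i}\subseteq\bigcup_{j\in\mathcal{I}_i}[\underline{x}_i^j,\overline{x}_i^j]$ and $\mathcal{X}_{u,i}\subseteq\bigcup_{j\in\mathcal{U}_i}[\underline{x}_i^j,\overline{x}_i^j]$. Interval product: for intervals $[\underline{a},\overline{a}],[\underline{b},\overline{b}]\subseteq\mathbb{R}$ and $c\in\mathbb{R}$, $$[\underline{a},\overline{a}]^\top c\,[\underline{b},\overline{b}]:=\min\{c\,\underline{a}\,\underline{b},\;c\,\underline{a}\,\overline{b},\;c\,\overline{a}\,\underline{b},\;c\,\overline{a}\,\overline{b}\}.$$ Interval-barrier function: with $\lambda\ge0$ fixed (common to all subsystems), a monotone function $\mathcal{B}_i:\mathcal{X}_i\to\mathbb{R}$ (i.e. $x\le y\Rightarrow\mathcal{B}_i(x)\le\mathcal{B}_i(y)$) is an interval-barrier function for $\Sigma_i$, with associated scalars $\gamma_i,\eta_i\in\mathbb{R}$ and symmetric matrix $X_i=\begin{bmatrix} X_i^{11} & X_i^{12} \\ X_i^{21} & X_i^{22} \end{bmatrix}\in\mathbb{R}^{2\times2}$, if (1) $\mathcal{B}_i(\overline{x}_i^j)\le\gamma_i$ for all $j\in\mathcal{I}_i$; (2) $\mathcal{B}_i(\underline{x}_i^j)\ge\eta_i$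 for all $j\in\mathcal{U}_i$; (3) $\mathcal{B}_i(g_i(\overline{x}_i^j,\overline{w}_i^k))\le\lambda\mathcal{B}_i(\underline{x}_i^j)+\mathcal{Z}_i^{j,k}$ for all $j\in\mathcal{P}_i$, $k\in\mathcal{Q}_i$, where $$\mathcal{Z}_i^{j,k}=[\underline{w}_i^k,\overline{w}_i^k]^\top X_i^{11}[\underline{w}_i^k,\overline{w}_i^k]+[\underline{w}_i^k,\overline{w}_i^k]^\top X_i^{12}[\underline{x}_i^j,\overline{x}_i^j]+[\underline{x}_i^j,\overline{x}_i^j]^\top X_i^{21}[\underline{w}_i^k,\overline{w}_i^k]+[\underline{x}_i^j,\overline{x}_i^j]^\top X_i^{22}[\underline{x}_i^j,\overline{x}_i^j].$$ Barrier certificate (for the overall system $x^+=g(x)$): a function $\mathcal{B}:\mathcal{X}\to\mathbb{R}$ is a barrier certificate with respect to $\mathcal{X}_u$ if there are $\gamma\le\delta\le\eta$ in $\mathbb{R}$ with $\mathcal{B}(x)\le\gamma$ for all $x\in\mathcal{X}_0$; $\mathcal{B}(x)>\eta$ for all $x\in\mathcal{X}_u$; and, for all $x\in\mathcal{X}$, $\mathcal{B}(x)\le\delta$ implies $\mathcal{B}(g(x))\le\delta$. Safety: $\Sigma$ is safe with respect to $\mathcal{X}_u$ if every trajectory $x_{t+1}=g(x_t)$ with $x_0\in\mathcal{X}_0$ satisfies $x_t\notin\mathcal{X}_u$ for all $t\ge0$. *)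

(* Defs.v *)
From HB Require Import structures.
From mathcomp Require Import all_boot all_order all_algebra.
From mathcomp Require Import boolp classical_sets set_interval reals.
Set Implicit Arguments.
Unset Strict Implicit.
Unset Printing Implicit Defensive.
Import Order.TTheory GRing.Theory Num.Theory.
Local Open Scope classical_set_scope.
Local Open Scope ring_scope.

Record cinterval (R : realType) := CInterval {
  lo : R;
  hi : R;
  lo_le_hi : lo <= hi }.

Definition cinterval_set (R : realType) (I : cinterval R) : set R :=
  `[lo I, hi I]%classic.

(* [a]^T c [b]: the least value of c * a * b over the four endpoint pairs *)
Definition interval_product (R : realType) (a : cinterval R) (c : R)
    (b : cinterval R) : R :=
  Num.min (Num.min (c * lo a * lo b) (c * lo a * hi b))
          (Num.min (c * hi a * lo b) (c * hi a * hi b)).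

(* A map defined on a subset of R is encoded as a total function; only its
   values on that subset are ever constrained or used. This applies to trans
   here and to the functions B below. *)
Record subsystem (R : realType) := Subsystem {
  state : set R;
  init : set R;
  input : set R;
  trans : R -> R -> R;
  init_state : init `<=` state;
  trans_state : forall x w, state x -> input w -> state (trans x w) }.

Definition monotone_subsystem (R : realType) (S : subsystem R) : Prop :=
  forall x y w v : R, state S x -> state S y -> input S w -> input S v ->
    x <= y -> w <= v -> trans S x w <= trans S y v.

Definition set_prod (R : realType) (N : nat) (A : 'I_N -> set R) :
    set 'cV[R]_N :=
  [set x | forall i, A i (x i 0)].

Record interconnection (R : realType) (N : nat) := Interconnection {
  sub : 'I_N -> subsystem R;
  conn : 'M[R]_N;
  conn_input : forall x : 'cV[R]_N, set_prod (fun i => state (sub i)) x ->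
    forall i, input (sub i) ((conn *m x) i 0) }.

Definition sys_state (R : realType) (N : nat) (S : interconnection R N) :
    set 'cV[R]_N :=
  set_prod (fun i => state (sub S i)).

Definition sys_init (R : realType) (N : nat) (S : interconnection R N) :
    set 'cV[R]_N :=
  set_prod (fun i => init (sub S i)).

Definition sys_trans (R : realType) (N : nat) (S : interconnection R N)
    (x : 'cV[R]_N) : 'cV[R]_N :=
  \col_i trans (sub S i) (x i 0) ((conn S *m x) i 0).

Definition monotone_interconnection (R : realType) (N : nat)
    (S : interconnection R N) : Prop :=
  forall i, monotone_subsystem (sub S i).

(* The interval families of one subsystem; Xu is its local unsafe set. The
   cells may overlap: only the covering properties are required. *)
Record covering (R : realType) (S : subsystem R) (Xu : set R) := Covering {
  xidx : finType;
  widx : finType;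
  xcell : xidx -> cinterval R;
  wcell : widx -> cinterval R;
  init_idx : {set xidx};
  unsafe_idx : {set xidx};
  state_cover : state S = \bigcup_j cinterval_set (xcell j);
  input_cover : input S = \bigcup_k cinterval_set (wcell k);
  init_cover :
    init S `<=` \bigcup_(j in [set` init_idx]) cinterval_set (xcell j);
  unsafe_cover :
    Xu `<=` \bigcup_(j in [set` unsafe_idx]) cinterval_set (xcell j) }.

(* Row and column 0 of X belong to the internal input w, 1 to the state x. *)
Definition supply (R : realType) (X : 'M[R]_2) (w x : cinterval R) : R :=
  interval_product w (X 0 0) w + interval_product w (X 0 1) x
  + interval_product x (X 1 0) w + interval_product x (X 1 1) x.

Record interval_barrier (R : realType) (S : subsystem R) (Xu : set R)
    (C : covering S Xu) (lambda : R) (B : R -> R) (gamma eta : R)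
    (X : 'M[R]_2) : Prop := IntervalBarrier {
  ib_monotone : forall x y, state S x -> state S y -> x <= y -> B x <= B y;
  ib_sym : X^T = X;
  ib_init : forall j, j \in init_idx C -> B (hi (xcell j)) <= gamma;
  ib_unsafe : forall j, j \in unsafe_idx C -> eta <= B (lo (xcell j));
  ib_step : forall (j : xidx C) (k : widx C),
    B (trans S (hi (xcell j)) (hi (wcell k)))
      <= lambda * B (lo (xcell j)) + supply X (wcell k) (xcell j) }.

Definition barrier_certificate (R : realType) (N : nat)
    (S : interconnection R N) (Xu : set 'cV[R]_N) (B : 'cV[R]_N -> R) : Prop :=
  exists gamma delta eta : R,
    [/\ gamma <= delta /\ delta <= eta,
        forall x, sys_init S x -> B x <= gamma,
        forall x, Xu x -> eta < B x &
        forall x, sys_state S x -> B x <= delta ->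
          B (sys_trans S x) <= delta].

Definition safe (R : realType) (N : nat) (S : interconnection R N)
    (Xu : set 'cV[R]_N) : Prop :=
  forall x : nat -> 'cV[R]_N,
    sys_init S (x 0%N) -> (forall t, x t.+1 = sys_trans S (x t)) ->
    forall t, ~ Xu (x t).

Definition col_mu1 (R : realType) (mu : R) : 'cV[R]_2 :=
  \col_(i < 2) if i == 0 then mu else 1.

(* Main.v *)
(* Monotonicity moves the step condition from the cell corners to every state x
   with input w = M x, and the corner minimum bounds the bilinear form from
   below, so B (g x) <= lambda * B x + x^T (X11 M^2 + 2 X12 M + X22) x. By the
   spectral theorem the last term is a nonnegative combination of the values
   X11 mu^2 + 2 X12 mu + X22 at the eigenvalues mu of the symmetric matrix M,
   all nonpositive; hence gamma = delta = eta = 0 gives a certificate. *)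
Require Import Defs.
From HB Require Import structures.
From mathcomp Require Import all_boot all_order all_algebra.
From mathcomp Require Import boolp classical_sets set_interval reals.
From mathcomp Require Import complex ring.
Set Implicit Arguments.
Unset Strict Implicit.
Unset Printing Implicit Defensive.
Import Order.TTheory GRing.Theory Num.Theory.
Local Open Scope classical_set_scope.
Local Open Scope ring_scope.

Section SymmetricQuadraticForm.
Local Open Scope sesquilinear_scope.

(** From [A = P^-1 D P] follows [P A = D P], so row [k] of [P] is an eigenvector for the [k]-th
    diagonal entry; [eigenvalue] refers to row vectors. *)
Lemma eigenvalue_spectral_diag (C : numClosedFieldType) (n : nat)
    (A : 'M[C]_n) (k : 'I_n) :
  A \is normalmx -> eigenvalue A (spectral_diag A 0 k).
Proof.
move=> /orthomx_spectralP A_diag; set P := spectralmx A in A_diag.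
have P_unit : P \in unitmx := spectral_unit A.
apply/eigenvalueP; exists (row k P).
  rewrite -row_mul {1}A_diag !mulmxA mulmxV // mul1mx.
  by apply/rowP=> j; rewrite mul_diag_mx !mxE.
(* A zero row of [P], multiplied by [P^-1], would make row [k] of the identity zero. *)
apply/eqP=> /(congr1 (mulmx^~ (invmx P))); rewrite mul0mx -row_mul mulmxV //.
by move=> /rowP/(_ k)/eqP; rewrite !mxE eqxx oner_eq0.
Qed.

(** Unitary diagonalization turns the form into the sum of [q_k |(P v)_k|^2], where [q_k] is the
    polynomial at the [k]-th eigenvalue. Eigenvalues of a Hermitian matrix are real, so the sign is
    asked at real [d] only. *)
Lemma hermitian_quad_le0 (C : numClosedFieldType) (n : nat) (A : 'M[C]_n)
    (a b c : C) (v : 'cV[C]_n) :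
  A \is hermsymmx ->
  (forall d, d \is Num.real -> eigenvalue A d -> a * d ^+ 2 + b * d + c <= 0) ->
  (v^t* *m (a *: (A *m A) + b *: A + c%:M) *m v) 0 0 <= 0.
Proof.
move=> A_herm q_le0; have A_normal := hermitian_normalmx A_herm.
have /orthomx_spectralP A_diag := A_normal.
set P := spectralmx A in A_diag; set d := spectral_diag A in A_diag.
have P_unit : P \in unitmx := spectral_unit A.
pose q := \row_k (a * d 0 k ^+ 2 + b * d 0 k + c).
have q_diag : diag_mx q = a *: (diag_mx d *m diag_mx d) + b *: diag_mx d + c%:M.
  rewrite mulmx_diag -diag_const_mx -!linearZ -!linearD /=; congr diag_mx.
  by apply/rowP=> k; rewrite !mxE expr2.
(* Conjugation by the unitary [P] commutes with taking polynomials. *)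
have -> : a *: (A *m A) + b *: A + c%:M = P^t* *m diag_mx q *m P.
  rewrite -invmx_unitary ?spectral_unitarymx // q_diag !(mulmxDr, mulmxDl).
  rewrite -!(scalemxAr, scalemxAl) -A_diag mul_mx_scalar -scalemxAl mulVmx //.
  rewrite scalemx1 {1 2}A_diag !mulmxA -(mulmxA _ P) mulmxV //.
  by rewrite mulmx1.
rewrite !mulmxA -(mulmxA _ P v) -map_mxM -trmx_mul.
rewrite -mulmxA mul_diag_mx mxE; apply: sumr_le0 => k _; rewrite !mxE.
rewrite mulrCA mulr_le0_ge0 //; last by rewrite mulrC mul_conjC_ge0.
apply: q_le0 (eigenvalue_spectral_diag k A_normal).
exact: (mxOverP (hermitian_spectral_diag_real A_herm)).
Qed.

(** Over [R[i]] the matrix [M] becomes Hermitian, and the real eigenvalues of its image are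
    eigenvalues of [M], so the complex bound restricts to [R]. *)
Lemma symmetric_quad_le0 (R : rcfType) (n : nat) (M : 'M[R]_n) (a b c : R)
    (x : 'cV[R]_n) :
  M^T = M ->
  (forall mu, eigenvalue M mu -> a * mu ^+ 2 + b * mu + c <= 0) ->
  (x^T *m (a *: (M *m M) + b *: M + c%:M) *m x) 0 0 <= 0.
Proof.
move=> M_sym q_le0; pose f := real_complex R.
have f_real (p q : nat) (Y : 'M[R]_(p, q)) : map_mx f Y \is a mxOver Num.real.
  by apply/mxOverP=> i j; rewrite mxE; apply/complex_realP; exists (Y i j).
have fM_herm : map_mx f M \is hermsymmx.
  apply: realsym_hermsym => //.
  by apply/is_hermitianmxP; rewrite expr0 scale1r map_mx_id // map_trmx M_sym.
have := @hermitian_quad_le0 _ _ _ (f a) (f b) (f c) (map_mx f x) fM_herm.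
rewrite map_trmx realmxC //.
rewrite -map_mxM -!map_mxZ -map_scalar_mx -!map_mxD -!map_mxM mxE lecR.
apply=> _ /complex_realP[mu ->]; rewrite eigenvalue_map => /q_le0.
by rewrite -lecR !rmorphD !rmorphM.
Qed.

End SymmetricQuadraticForm.

Lemma mul_ge_endpoint (R : realDomainType) (l h c x : R) :
  l <= x <= h -> c * l <= c * x \/ c * h <= c * x.
Proof.
move=> /andP[lx xh]; have [c_ge0|/ltW c_le0] := leP 0 c.
  by left; apply: ler_wpM2l.
by right; apply: ler_wnM2l.
Qed.

(** The form [c x y] is linear in each variable: with [x] fixed, [y] moves to an endpoint [z]
    without increasing it, and then [x] does so with [z] fixed. *)
Lemma interval_product_le (R : realType) (a b : cinterval R) (c x y : R) :
  cinterval_set a x -> cinterval_set b y ->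
  interval_product a c b <= c * x * y.
Proof.
rewrite /cinterval_set /= !in_itv /= => xa yb.
rewrite /interval_product !ge_min.
have [hy|hy] := mul_ge_endpoint (c * x) yb;
  [set z := lo b in hy * | set z := hi b in hy *];
  have [hx|hx] := mul_ge_endpoint (c * z) xa; rewrite !(mulrAC c z) in hx;
  by rewrite (le_trans hx hy) ?orbT.
Qed.

Lemma supply_le (R : realType) (X : 'M[R]_2) (iw ix : cinterval R) (w x : R) :
  X^T = X -> cinterval_set iw w -> cinterval_set ix x ->
  supply X iw ix <= X 0 0 * w ^+ 2 + X 0 1 *+ 2 * w * x + X 1 1 * x ^+ 2.
Proof.
move=> X_sym w_iw x_ix.
have X01 : X 1 0 = X 0 1 by rewrite -[in LHS]X_sym mxE.
have := lerD (lerD (lerD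
    (interval_product_le (X 0 0) w_iw w_iw)
    (interval_product_le (X 0 1) w_iw x_ix))
    (interval_product_le (X 1 0) x_ix w_iw))
    (interval_product_le (X 1 1) x_ix x_ix).
rewrite -/(supply X iw ix) => /le_trans; apply; rewrite X01.
by rewrite le_eqVlt; apply/orP; left; apply/eqP; ring.
Qed.

Lemma cinterval_lo (R : realType) (I : cinterval R) : cinterval_set I (lo I).
Proof. by rewrite /cinterval_set /= in_itv /= lexx lo_le_hi. Qed.

Lemma cinterval_hi (R : realType) (I : cinterval R) : cinterval_set I (hi I).
Proof. by rewrite /cinterval_set /= in_itv /= lexx lo_le_hi. Qed.

Section Barrier.
Variables (R : realType) (S : subsystem R) (Xu : set R) (C : covering S Xu).

Lemma xcell_state (j : xidx C) : cinterval_set (xcell j) `<=` state S.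
Proof. by rewrite (state_cover C) => x jx; exists j. Qed.

Lemma wcell_input (k : widx C) : cinterval_set (wcell k) `<=` input S.
Proof. by rewrite (input_cover C) => w kw; exists k. Qed.

Variables (lambda : R) (B : R -> R) (gamma eta : R) (X : 'M[R]_2).
Hypothesis B_barrier : interval_barrier C lambda B gamma eta X.

Lemma barrier_init (x : R) : init S x -> B x <= gamma.
Proof.
move=> x_init; have [j /= jI jx] := init_cover C x_init.
apply: le_trans (ib_init B_barrier jI); apply: (ib_monotone B_barrier).
- exact: init_state.
- exact/xcell_state/cinterval_hi.
- by move: jx; rewrite /cinterval_set /= in_itv => /andP[].
Qed.

Lemma barrier_unsafe (x : R) : Xu x -> eta <= B x.
Proof.
move=> x_unsafe; have [j /= jU jx] := unsafe_cover C x_unsafe.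
apply: le_trans (ib_unsafe B_barrier jU) _; apply: (ib_monotone B_barrier).
- exact/xcell_state/cinterval_lo.
- exact: xcell_state jx.
- by move: jx; rewrite /cinterval_set /= in_itv => /andP[].
Qed.

(** Pick cells containing [x] and [w]. The left side grows when both arguments rise to the upper
    endpoints; after the cell inequality, [lambda >= 0] lets [lo (xcell j)] rise back to [x]. *)
Lemma barrier_step (x w : R) : monotone_subsystem S -> 0 <= lambda ->
  state S x -> input S w ->
  B (trans S x w) <= lambda * B x
    + (X 0 0 * w ^+ 2 + X 0 1 *+ 2 * w * x + X 1 1 * x ^+ 2).
Proof.
move=> S_mono lambda_ge0 Sx Sw.
have [j _ jx] : (\bigcup_j cinterval_set (@xcell _ _ _ C j)) x.
  by rewrite -state_cover.
have [k _ kw] : (\bigcup_k cinterval_set (@wcell _ _ _ C k)) w.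
  by rewrite -input_cover.
have [jlo jhi] := (xcell_state (cinterval_lo (xcell j)),
  xcell_state (cinterval_hi (xcell j))).
have khi := wcell_input (cinterval_hi (wcell k)).
have /andP[xlo xhi] : lo (xcell j) <= x <= hi (xcell j).
  by move: jx; rewrite /cinterval_set /= in_itv.
have /andP[_ whi] : lo (wcell k) <= w <= hi (wcell k).
  by move: kw; rewrite /cinterval_set /= in_itv.
apply: (@le_trans _ _ (B (trans S (hi (xcell j)) (hi (wcell k))))).
  by apply: (ib_monotone B_barrier); [exact: trans_state..|exact: S_mono].
apply: le_trans (ib_step B_barrier j k) _; apply: lerD.
  by rewrite ler_wpM2l // (ib_monotone B_barrier).
exact: supply_le (ib_sym B_barrier) kw jx.
Qed.

End Barrier.

(** Symmetry of [M] gives [x^T M M x = (M x)^T (M x)], the sum of the squared internal inputs. *)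
Lemma quad_formE (R : comNzRingType) (n : nat) (M : 'M[R]_n) (a b c : R)
    (x : 'cV[R]_n) : M^T = M ->
  \sum_i (a * (M *m x) i 0 ^+ 2 + b * (M *m x) i 0 * x i 0 + c * x i 0 ^+ 2)
  = (x^T *m (a *: (M *m M) + b *: M + c%:M) *m x) 0 0.
Proof.
move=> M_sym.
have dotE (u v : 'cV[R]_n) : (u^T *m v) 0 0 = \sum_i u i 0 * v i 0.
  by rewrite mxE; apply: eq_bigr => i _; rewrite mxE.
rewrite -mulmxA !mulmxDl -!scalemxAl mul_scalar_mx !mulmxDr -!scalemxAr.
rewrite -mulmxA [x^T *m (M *m (M *m x))]mulmxA -[in x^T *m M]M_sym -trmx_mul.
rewrite ![fun_of_matrix (_ + _) _ _]mxE ![fun_of_matrix (_ *: _) _ _]mxE.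
rewrite !dotE !mulr_sumr -!big_split /=.
by apply: eq_bigr => i _; ring.
Qed.

Lemma col_mu1_quadE (R : realType) (X : 'M[R]_2) (mu : R) : X^T = X ->
  ((col_mu1 mu)^T *m X *m col_mu1 mu) 0 0
  = X 0 0 * mu ^+ 2 + X 0 1 *+ 2 * mu + X 1 1.
Proof.
move=> X_sym; have X01 : X 1 0 = X 0 1 by rewrite -[in LHS]X_sym mxE.
rewrite mxE big_ord_recl big_ord1 !mxE !big_ord_recl !big_ord0 !mxE /=.
rewrite (_ : lift 0 0 = 1); last exact: val_inj.
by rewrite X01; ring.
Qed.

(** The states with [B <= delta] form an invariant set that contains the initial states and, as
    [delta <= eta], misses [Xu]. The induction also carries membership in the state set, which the
    step condition presupposes. *)
Lemma barrier_certificate_safe (R : realType) (N : nat)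
    (S : interconnection R N) (Xu : set 'cV[R]_N) (B : 'cV[R]_N -> R) :
  barrier_certificate S Xu B -> safe S Xu.
Proof.
move=> [gamma [delta [eta [[gd de] B_init B_unsafe B_step]]]] x x0 x_step t.
have [_ Bt] : sys_state S (x t) /\ B (x t) <= delta.
  elim: t => [|t [St Bt]].
    by split; [move=> i; apply: init_state | apply: le_trans (B_init _ x0) gd].
  rewrite x_step; split; last exact: B_step.
  by move=> i; rewrite mxE; apply: trans_state; [exact: St|exact: conn_input].
by move=> /B_unsafe; rewrite ltNge (le_trans Bt de).
Qed.

Theorem theorem3 (R : realType) (N : nat) (Sigma : interconnection R N)
  (Xu : 'I_N -> set R)
  (C : forall i : 'I_N, covering (sub Sigma i) (Xu i))
  (lambda : R) (B : 'I_N -> R -> R) (gamma eta : 'I_N -> R) (X : 'M[R]_2)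
  (Sigma_monotone : monotone_interconnection Sigma)
  (Xu_state : forall i : 'I_N, Xu i `<=` state (sub Sigma i))
  (lambda_ge0 : 0 <= lambda)
  (M_sym : (conn Sigma)^T = conn Sigma)
  (B_barrier : forall i : 'I_N,
     interval_barrier (C i) lambda (B i) (gamma i) (eta i) X)
  (X_eigen : forall mu : R, eigenvalue (conn Sigma) mu ->
     ((col_mu1 mu)^T *m X *m col_mu1 mu) 0 0 <= 0)
  (gamma_le0 : \sum_(i < N) gamma i <= 0)
  (eta_gt0 : 0 < \sum_(i < N) eta i) :
  barrier_certificate Sigma (set_prod Xu)
    (fun x : 'cV[R]_N => \sum_(i < N) B i (x i 0))
  /\ safe Sigma (set_prod Xu).
Proof.
set BB := (fun x : 'cV[R]_N => \sum_(i < N) B i (x i 0)).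
suff BC : barrier_certificate Sigma (set_prod Xu) BB.
  by split=> //; apply: barrier_certificate_safe BC.
(* Level zero works for every [lambda >= 0], since multiplication by [lambda] keeps [B x <= 0]. *)
exists 0, 0, 0; split=> // [x x_init|x x_unsafe|x x_state Bx_le0].
- apply: le_trans gamma_le0; apply: ler_sum => i _.
  exact: (barrier_init (B_barrier i)) (x_init i).
- apply: lt_le_trans eta_gt0 _; apply: ler_sum => i _.
  exact: (barrier_unsafe (B_barrier i)) (x_unsafe i).
have X_sym : X^T = X.
  (* Any one subsystem supplies the symmetry of [X]; [N = 0] is impossible, as the empty sum of the
     [eta i] is not positive. *)
  case: (pickP (@predT 'I_N)) => [i _|no_i].
    exact: ib_sym (B_barrier i).
  by move: eta_gt0; rewrite big_pred0 ?ltxx.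
have quad_le0 := @symmetric_quad_le0 _ _ _ (X 0 0) (X 0 1 *+ 2) (X 1 1) x M_sym.
(* The summed local steps give [lambda * BB x] plus a quadratic form in [x] that is at most zero. *)
apply: (@le_trans _ _ (lambda * BB x)); last exact: mulr_ge0_le0.
rewrite -[leRHS]addr0; apply: le_trans (lerD (lexx _) (quad_le0 _)); last first.
  by move=> mu /X_eigen; rewrite col_mu1_quadE.
rewrite -quad_formE // mulr_sumr -big_split /=; apply: ler_sum => i _.
rewrite mxE; apply: (barrier_step (B_barrier i)) => //.
exact: conn_input.
Qed.
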